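(* Let $n\ge1$. The net-degree sequence of a bigraph $B$ on $[n]$ is uniquely realizable if and only if every node of $B$ is a sink or a source and there is at most one pair of distinct nodes not joined by an edge. In particular, a net-degree sequence $\mathbf d=(d_1,\dots,d_n)\in\mathbb Z^n$ of a bigraph on $[n]$ is uniquely realizable if and only if $n-2\le |d_i|\le n-1$ for all $i=1,\dots,n$ and there are at most two indices $i$ with $|d_i|=n-2$.
   Context: $[n]=\{1,\dots,n\}$. A bidirected graph (bigraph) is a pair $B=(G,\tau)$ where $G=(V,E)$ is a finite simple undirected graph (no loops, no parallel edges) and $\tau:V\times E\to\{-1,0,1\}$ satisfies $\tau(v,e)\in\{-1,1\}$ if $v$ is incident to $e$ and $\tau(v,e)=0$ otherwise. Its net-degree sequence is $\mathbf d(B)\in\mathbb Z^V$, $\mathbf d(B)_v=\sum_{e\in E}\tau(v,e)$. A net-degree sequence $\mathbf d\in\mathbb Z^n$ is uniquely realizable if there is exactly one bigraph $B$ on the (labelled) node set $[n]$ with $\mathbf d(B)=\mathbf d$. A node $v$ is a sink if $\tau(v,e)=1$ for all edges $e$ incident to $v$, and a source if $\tau(v,e)=-1$ for all edges $e$ incident to $v$ (an isolated node is both). *)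

(* Defs.v *)
From mathcomp Require Import all_boot all_order all_algebra.

Set Implicit Arguments.
Unset Strict Implicit.
Unset Printing Implicit Defensive.

Import Order.TTheory GRing.Theory Num.Theory.
Local Open Scope ring_scope.

(* The axioms of both records are boolean, hence proof-irrelevant: Leibniz
   equality of graphs is equality of edge sets, and Leibniz equality of
   bigraphs is equality of the edge sets and of the maps tau. *)
Record sgraph (V : finType) := SGraph {
  edges : {set {set V}};
  edges_card2 : [forall e in edges, #|e| == 2]
}.

(* tau has domain V * {set V} instead of V * edges G: it is extended by 0 to
   the pairs (v, e) where e is not an edge, so the extension adds no data. *)
Record bigraph (V : finType) := Bigraph {
  bg_graph :> sgraph V;
  tau : {ffun V * {set V} -> int};
  tauP : [forall v, forall e,
    if (e \in edges bg_graph) && (v \in e)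
    then (tau (v, e) == 1) || (tau (v, e) == -1)
    else tau (v, e) == 0]
}.

Definition netdeg (V : finType) (B : bigraph V) : {ffun V -> int} :=
  [ffun v => \sum_(e in edges B) tau B (v, e)].

Definition is_netdeg_seq (n : nat) (d : {ffun 'I_n -> int}) : Prop :=
  exists B : bigraph 'I_n, netdeg B = d.

Definition uniquely_realizable (n : nat) (d : {ffun 'I_n -> int}) : Prop :=
  exists! B : bigraph 'I_n, netdeg B = d.

Definition is_sink (V : finType) (B : bigraph V) (v : V) : Prop :=
  forall e : {set V}, e \in edges B -> v \in e -> tau B (v, e) = 1.

Definition is_source (V : finType) (B : bigraph V) (v : V) : Prop :=
  forall e : {set V}, e \in edges B -> v \in e -> tau B (v, e) = -1.

Definition nonedges (V : finType) (G : sgraph V) : {set {set V}} :=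
  [set e : {set V} | (#|e| == 2) && (e \notin edges G)].

(* Main.v *)
(* A bigraph is encoded by the V x V matrix with entries tau(v, {v, w}); its
   net-degrees are the row sums.

   If the realization is unique, two half-edges of opposite signs at a node
   cannot exist, since exchanging them gives another realization; hence every
   node is a sink or a source. Two distinct nonedges lie on a cycle of length 3
   or 4 of the complete graph in which every node is on a nonedge; exchanging
   edges and nonedges along this cycle gives another realization, in which an
   edge passes its sign on to the nonedge that replaces it, and two nonedges at
   a node become edges of opposite signs.

   Conversely, let |d_v| >= n - 2. The sum over w != v of 1 - s tau(v, {v, w}),
   where s is the sign of d_v, equals n - 1 - |d_v| <= 1, so no half-edge at v
   has sign -s, and v has n - 1 - |d_v| non-neighbours. If at most two nodes
   have |d_v| = n - 2, these two nodes are the only possible nonedge, and the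
   sequence determines everything. *)
Require Import Defs.
From mathcomp Require Import all_boot all_order all_algebra.
From mathcomp Require Import zify.

Set Implicit Arguments.
Unset Strict Implicit.
Unset Printing Implicit Defensive.

Import Order.TTheory GRing.Theory Num.Theory.
Local Open Scope ring_scope.

(** * Bigraphs as matrices with entries 0, 1 and -1 *)

Lemma cards2_eq_set2 (T : finType) (e : {set T}) (v : T) :
  #|e| = 2%N -> v \in e -> exists2 w, v != w & e = [set v; w].
Proof.
move=> /eqP/cards2P[x [y [xy ->]]]; rewrite !inE => /orP[/eqP->|/eqP->].
  by exists y.
by exists x; rewrite 1?eq_sym // setUC.
Qed.

Lemma set2_injr (T : finType) (v w x : T) :
  [set v; w] = [set v; x] -> w = x.
Proof.
move=> E; have : w \in [set v; x] by rewrite -E set22.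
have : x \in [set v; w] by rewrite E set22.
by rewrite !inE => /orP[/eqP->|/eqP->] // /orP[/eqP->|/eqP->].
Qed.

(** By [hmxP] and [hmx_surj] these are exactly the matrices of bigraphs: the zero pattern is
    symmetric, while the signs at the two ends of an edge are independent. *)
Definition half_matrix (V : Type) (M : V -> V -> int) : Prop :=
  [/\ forall v, M v v = 0,
      forall v w, M v w \in [:: 0; 1; -1]
    & forall v w, (M v w == 0) = (M w v == 0)].

Definition hmx (V : finType) (B : bigraph V) (v w : V) : int :=
  tau B (v, [set v; w]).

Section HalfMatrix.

Variable V : finType.
Implicit Types (B : bigraph V) (M : V -> V -> int) (e : {set V}) (v w : V).

Lemma card_edge B e : e \in edges B -> #|e| = 2%N.
Proof. by move=> He; have /forall_inP/(_ e He)/eqP := edges_card2 B. Qed.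

Lemma tau_edge B v e : e \in edges B -> v \in e ->
  tau B (v, e) = 1 \/ tau B (v, e) = -1.
Proof.
move=> He ve; have /forallP/(_ v)/forallP/(_ e) := tauP B.
by rewrite He ve => /orP[]/eqP; [left|right].
Qed.

Lemma tau_out B v e : ~~ ((e \in edges B) && (v \in e)) -> tau B (v, e) = 0.
Proof.
move=> /negPf H; have /forallP/(_ v)/forallP/(_ e) := tauP B.
by rewrite H => /eqP.
Qed.

Lemma tau_eq0 B v e : v \in e -> (tau B (v, e) == 0) = (e \notin edges B).
Proof.
move=> ve; case: (boolP (e \in edges B)) => He.
  by case: (tau_edge He ve) => ->.
by rewrite tau_out ?(negPf He).
Qed.

Lemma hmx_eq0 B v w : (hmx B v w == 0) = ([set v; w] \notin edges B).
Proof. by rewrite tau_eq0 // set21. Qed.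

Lemma hmxP B : half_matrix (hmx B).
Proof.
split=> [v|v w|v w].
- apply/eqP; rewrite hmx_eq0; apply/negP => /card_edge.
  by rewrite setUid cards1.
- case: (boolP ([set v; w] \in edges B)) => H; last first.
    by rewrite (eqP (_ : hmx B v w == 0)) // hmx_eq0.
  by rewrite /hmx; case: (tau_edge H (set21 _ _)) => ->.
- by rewrite !hmx_eq0 setUC.
Qed.

Lemma netdeg_hmx B v : netdeg B v = \sum_w hmx B v w.
Proof.
have [h0 _ _] := hmxP B.
rewrite ffunE (bigD1 v) //= h0 add0r.
(* Sending [w] to [[set v; w]] is injective, so the row sum becomes a sum over sets. Both sums are
   then extended by 0 to all sets and compared termwise. *)
rewrite -(big_imset (h := fun w => [set v; w]) (fun e => tau B (v, e))) /=;
  last by move=> x y _ _ /set2_injr.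
rewrite big_mkcond [RHS]big_mkcond /=; apply: eq_bigr => e _.
case: (boolP (e \in edges B)) => He; case: imsetP => [[w wv Ew]|He'] //.
  apply: tau_out; apply/negP => /andP[_ ve]; apply: He'.
  by have [w vw ->] := cards2_eq_set2 (card_edge He) ve; exists w;
    rewrite // unfold_in eq_sym.
by rewrite tau_out // (negPf He).
Qed.

Lemma hmx_inj B B' : (forall v w, hmx B v w = hmx B' v w) -> B = B'.
Proof.
move=> E.
have Ee : edges B = edges B'.
  apply/setP => e; apply/idP/idP => He.
    have /eqP/cards2P[x [y [_ Exy]]] := card_edge He; rewrite Exy in He *.
    by rewrite -[_ \in _]negbK -hmx_eq0 -E hmx_eq0 negbK.
  have /eqP/cards2P[x [y [_ Exy]]] := card_edge He; rewrite Exy in He *.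
  by rewrite -[_ \in _]negbK -hmx_eq0 E hmx_eq0 negbK.
have Et : tau B = tau B'.
  apply/ffunP => -[v e]; case: (boolP ((e \in edges B) && (v \in e))) => H.
    case/andP: (H) => /card_edge He ve.
    by have [w _ ->] := cards2_eq_set2 He ve; apply: E.
  by rewrite !tau_out // -Ee.
case: B B' Ee Et {E} => [[E c] t p] [[E' c'] t' p'] /= EE Et.
subst E'; rewrite (bool_irrelevance c' c) in p' *; subst t'.
by rewrite (bool_irrelevance p' p).
Qed.

Lemma hmx_surj M : half_matrix M -> exists B, forall v w, hmx B v w = M v w.
Proof.
case=> M0 M3 Msym.
pose E := [set e : {set V} | (#|e| == 2%N) &&
  [forall v in e, forall w in e, (v != w) ==> (M v w != 0)]].
have EP v w : ([set v; w] \in E) = (M v w != 0).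
  rewrite inE cards2; have [->|vw] /= := eqVneq v w; first by rewrite M0 eqxx.
  apply/forall_inP/idP => [/(_ v (set21 _ _))/forall_inP/(_ w (set22 _ _))|H x].
    by rewrite vw.
  rewrite !inE => Hx; apply/forall_inP => y; rewrite !inE => Hy.
  apply/implyP.
  by case/orP: Hx => /eqP->; case/orP: Hy => /eqP->; rewrite ?eqxx // Msym.
have E2 : [forall e in E, #|e| == 2%N].
  by apply/forall_inP => e; rewrite inE => /andP[].
(* On [[set v; w]] the sum is [M v v + M v w = M v w]; this avoids choosing the other end of an
   edge. *)
pose t := [ffun p : V * {set V} =>
  if (p.2 \in E) && (p.1 \in p.2) then \sum_(w in p.2) M p.1 w else 0].
have tE v w : t (v, [set v; w]) = M v w.
  rewrite ffunE /= set21 andbT EP; have [->//|] := eqVneq (M v w) 0.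
  have [->|vw _ /=] := eqVneq v w; first by rewrite M0 eqxx.
  by rewrite big_setU1 ?inE //= big_set1 M0 add0r.
have tP : [forall v, forall e, if (e \in edges (SGraph E2)) && (v \in e)
    then (t (v, e) == 1) || (t (v, e) == -1) else t (v, e) == 0].
  apply/forallP => v; apply/forallP => e; rewrite [edges _]/=.
  case: ifP => [/andP[eE ve]|H]; last by rewrite ffunE /= H.
  have /eqP e2 : #|e| == 2%N by move: eE; rewrite inE => /andP[].
  have [w _ Ew] := cards2_eq_set2 e2 ve; subst e; rewrite tE.
  by move: eE (M3 v w); rewrite EP !inE => /negPf->.
by exists (Bigraph tP).
Qed.

End HalfMatrix.

(** * Exchanging two entries of a row *)

Section SwapRow.

Variable V : finType.
Implicit Types (f : V -> int) (p q : V).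

(* Exchanges the entries at p and q, except that two zeros become 1 and -1, so
   that f p = 0 or f q = 0 makes the zeros at p and q change status. *)
Definition swap_row f p q : V -> int := fun y =>
  if y == p then if (f p == 0) && (f q == 0) then 1 else f q else
  if y == q then if (f p == 0) && (f q == 0) then -1 else f p else f y.

Lemma sum_swap_row f p q : p != q ->
  \sum_y swap_row f p q y = \sum_y f y.
Proof.
move=> pq; have qp : q != p by rewrite eq_sym.
rewrite (bigD1 p) // (bigD1 q) //= [RHS](bigD1 p) // [in RHS](bigD1 q) //=.
rewrite !addrA; congr (_ + _); last first.
  by apply: eq_bigr => y /andP[yp yq]; rewrite /swap_row (negPf yp) (negPf yq).
rewrite /swap_row !eqxx (negPf qp).
by case: ifP => [/andP[/eqP-> /eqP->]|_] //; rewrite addrC.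
Qed.

Lemma swap_row_mem f p q y : (forall z, f z \in [:: 0; 1; -1]) ->
  swap_row f p q y \in [:: 0; 1; -1].
Proof. by move=> H; rewrite /swap_row; do !case: ifP => // _. Qed.

Lemma swap_row_eq0 f p q y : f p != 0 -> f q != 0 ->
  (swap_row f p q y == 0) = (f y == 0).
Proof.
move=> /negPf fp /negPf fq; rewrite /swap_row fp /= .
by case: (eqVneq y p) => [->|_]; [|case: (eqVneq y q) => [->|_]];
  rewrite ?fp ?fq.
Qed.

Lemma swap_row_toggle f p q y : p != q -> (f p == 0) || (f q == 0) ->
  (swap_row f p q y == 0) = (y \in [set p; q]) (+) (f y == 0).
Proof.
move=> pq; rewrite /swap_row !inE.
have [->|_] := eqVneq y p.
  by case fp: (f p == 0); case fq: (f q == 0); rewrite //= ?fp ?fq.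
have [->|_] //= := eqVneq y q.
by case fp: (f p == 0); case fq: (f q == 0); rewrite //= ?fp ?fq.
Qed.

End SwapRow.

(** * Consequences of unique realizability *)

Section Unique.

Variables (V : finType) (B : bigraph V).
Hypothesis uB : forall B', netdeg B' = netdeg B -> B' = B.
Implicit Types (v w : V).

(** Carries uniqueness over to matrices: a contradiction only needs a half-matrix with the same row
    sums and one different entry. *)
Lemma unique_hmx (M : V -> V -> int) : half_matrix M ->
  (forall v, \sum_w M v w = \sum_w hmx B v w) ->
  forall v w, M v w = hmx B v w.
Proof.
move=> /hmx_surj[B' E] S v w; rewrite -E; congr (hmx _ v w); apply: uB.
apply/ffunP => x; rewrite !netdeg_hmx -S.
by apply: eq_bigr => y _; rewrite E.
Qed.

Lemma unique_sign v p q : hmx B v p = 1 -> hmx B v q = -1 -> False.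
Proof.
move=> vp vq; have [M0 M3 Ms] := hmxP B.
have pq : p != q by apply/eqP => pq; move: vq; rewrite -pq vp.
pose M x := if x == v then swap_row (hmx B v) p q else hmx B x.
have M'0 x y : (M x y == 0) = (hmx B x y == 0).
  rewrite /M; case: (eqVneq x v) => // ->.
  by rewrite swap_row_eq0 ?vp ?vq.
have hM : half_matrix M.
  split=> [x|x y|x y]; last by rewrite !M'0.
    by apply/eqP; rewrite M'0 M0.
  by rewrite /M; case: ifP => // _; apply: swap_row_mem.
have : M v p = hmx B v p.
  apply: unique_hmx => // x; rewrite /M; case: (eqVneq x v) => // ->.
  exact: sum_swap_row.
by rewrite /M eqxx /swap_row eqxx vp vq.
Qed.

(** Here [c] lists a cycle of the complete graph; the second hypothesis excludes lengths 1 and 2,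
    the third puts each node on a nonedge of the cycle. Exchanging, in each row of [c], the entries
    at the predecessor and the successor keeps the row sums and changes the status of exactly the
    pairs on the cycle, seen from both ends. *)
Lemma unique_cycle (c : seq V) : uniq c ->
  {in c, forall v, prev c v != next c v} ->
  {in c, forall v, (hmx B v (prev c v) == 0) || (hmx B v (next c v) == 0)} ->
  c = [::].
Proof.
move=> Uc c3 c0; have [M0 M3 Ms] := hmxP B.
pose C v w := (v \in c) && (w \in [set prev c v; next c v]).
have Cs v w : C v w -> C w v.
  rewrite /C !inE => /andP[vc /orP[]/eqP->];
  by rewrite ?mem_prev ?mem_next ?vc ?next_prev ?prev_next ?eqxx ?orbT.
(* A node that is its own predecessor or successor is both, against [c3]. Hence the diagonal stays
   0. *)
have CC v : C v v = false.
  apply/negP => /andP[vc]; rewrite !inE => H; move: (c3 v vc).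
  case/orP: H => /eqP H.
    have N : next c v = v by rewrite {1}H next_prev.
    by rewrite -H N eqxx.
  have P : prev c v = v by rewrite {1}H prev_next.
  by rewrite -H P eqxx.
pose M v := if v \in c then swap_row (hmx B v) (prev c v) (next c v)
  else hmx B v.
have M'0 v w : (M v w == 0) = C v w (+) (hmx B v w == 0).
  rewrite /M /C; case: ifP => // vc.
  by rewrite swap_row_toggle ?c3 ?c0.
have hM : half_matrix M.
  split=> [v|v w|v w].
  - by apply/eqP; rewrite M'0 CC M0.
  - by rewrite /M; case: ifP => // _; apply: swap_row_mem.
  - by rewrite !M'0 Ms; congr (_ (+) _); apply/idP/idP => /Cs.
have c_empty x : x \notin c.
  apply/negP => xc; have Cx : C x (next c x) by rewrite /C xc !inE eqxx orbT.
  (* This entry changes status in [M], yet uniqueness makes it equal to the original one. *)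
  have := M'0 x (next c x); rewrite Cx (unique_hmx hM).
    by case: (_ == 0).
  by move=> v; rewrite /M; case: ifP => // vc; apply: sum_swap_row; apply: c3.
by case: c c_empty {Uc c3 c0 C M Cs CC M'0 hM} => // x s /(_ x);
  rewrite mem_head.
Qed.

Lemma unique_sink_source v : is_sink B v \/ is_source B v.
Proof.
case: (boolP [exists p, hmx B v p == 1]) => [/existsP[p /eqP vp]|Hn].
  left=> e eE ve; have [w _ Ee] := cards2_eq_set2 (card_edge eE) ve.
  case: (tau_edge eE ve) => // N; rewrite Ee in N.
  by case: (unique_sign vp N).
right=> e eE ve; have [w _ Ee] := cards2_eq_set2 (card_edge eE) ve.
case: (tau_edge eE ve) => // P; case/existsP: Hn; exists w.
by rewrite /hmx -Ee P.
Qed.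

Lemma unique_nonedges : (#|nonedges B| <= 1)%N.
Proof.
rewrite leqNgt; apply/negP => /card_gt1P[e [f [He Hf ef]]].
move: He Hf; rewrite !inE => /andP[/eqP e2 He] /andP[/eqP f2 Hf].
(* Both orientations of a disequality as rewrite rules, by which [prev] and [next] are computed on
   explicit lists. *)
have neqs (y z : V) : y != z -> ((y == z) = false) * ((z == y) = false).
  by move=> /negPf yz; rewrite yz eq_sym yz.
case: (boolP [disjoint e & f]) => [dis|]; last first.
  rewrite disjoint_subset => /subsetPn[u ue]; rewrite inE negbK => uf.
  have [v uv Ee] := cards2_eq_set2 e2 ue; have [w uw Ef] := cards2_eq_set2 f2 uf.
  have vw : v != w by apply: contraNneq ef => vw; rewrite Ee Ef vw.
  have nvu : hmx B v u == 0 by rewrite hmx_eq0 setUC -Ee.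
  have nuv : hmx B u v == 0 by rewrite hmx_eq0 -Ee.
  have nwu : hmx B w u == 0 by rewrite hmx_eq0 setUC -Ef.
  have negE := (neqs _ _ uv, neqs _ _ uw, neqs _ _ vw).
  (* The nonedges [uv] and [uw] share [u], and together they meet every node of this triangle. *)
  suff : [:: u; v; w] = [::] by [].
  apply: unique_cycle => [|x|x]; rewrite /= !inE ?negE //;
    case/or3P => /eqP->; rewrite /= ?eqxx ?negE ?eqxx ?negE //.
  - by rewrite nuv orbT.
  - by rewrite nvu.
  - by rewrite nwu orbT.
have /cards2P[u [v [uv Ee]]] : #|e| == 2%N by rewrite e2.
have /cards2P[w [x [wx Ef]]] : #|f| == 2%N by rewrite f2.
have dif y z : y \in e -> z \in f -> y != z.
  by move=> ye zf; apply: contraTneq ye => ->; rewrite (disjointFl dis zf).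
have ue : u \in e by rewrite Ee set21.
have ve : v \in e by rewrite Ee set22.
have wf : w \in f by rewrite Ef set21.
have xf : x \in f by rewrite Ef set22.
have [uw ux vw vx] := And4 (dif _ _ ue wf) (dif _ _ ue xf) (dif _ _ ve wf)
  (dif _ _ ve xf).
have nuv : hmx B u v == 0 by rewrite hmx_eq0 -Ee.
have nvu : hmx B v u == 0 by rewrite hmx_eq0 setUC -Ee.
have nwx : hmx B w x == 0 by rewrite hmx_eq0 -Ef.
have nxw : hmx B x w == 0 by rewrite hmx_eq0 setUC -Ef.
have negE := (neqs _ _ uv, neqs _ _ wx, neqs _ _ uw, neqs _ _ ux,
  neqs _ _ vw, neqs _ _ vx).
(* The disjoint nonedges [uv] and [wx] are opposite sides of this 4-cycle; the status of the other
   two sides does not matter. *)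
suff : [:: u; v; w; x] = [::] by [].
apply: unique_cycle => [|y|y]; rewrite /= !inE ?negE //;
  case/or4P => /eqP->; rewrite /= ?eqxx ?negE ?eqxx ?negE //.
- by rewrite nuv orbT.
- by rewrite nvu.
- by rewrite nwx orbT.
- by rewrite nxw.
Qed.

End Unique.

(** * Absolute net-degrees and numbers of non-neighbours *)

Section Degree.

Variable V : finType.
Implicit Types (B : bigraph V) (d : {ffun V -> int}) (v w : V).

Definition nbrs B v : {set V} := [set w | hmx B v w != 0].
Definition non_nbrs B v : {set V} := [set w | (w != v) && (hmx B v w == 0)].

Definition nearly_full d : {set V} := [set v | `|d v| == #|V|%:Z - 2].

Definition large_degrees d : Prop :=
  (forall v, #|V|%:Z - 2 <= `|d v| <= #|V|%:Z - 1) /\ (#|nearly_full d| <= 2)%N.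

Lemma card_nbrs B v : #|V| = (#|nbrs B v| + #|non_nbrs B v|).+1.
Proof.
have [h0 _ _] := hmxP B.
have vN : v \notin nbrs B v by rewrite inE h0 eqxx.
rewrite -(cardsC (nbrs B v)) -addnS; congr (_ + _)%N.
have -> : ~: nbrs B v = v |: non_nbrs B v.
  apply/setP => w; rewrite !inE negbK.
  by have [->|] //= := eqVneq w v; rewrite h0 eqxx.
by rewrite cardsU1 !inE eqxx.
Qed.

Lemma netdeg_signed B v (s : int) : (forall w, hmx B v w \in [:: 0; s]) ->
  netdeg B v = s * #|nbrs B v|%:Z.
Proof.
move=> H; rewrite netdeg_hmx (bigID (mem (nbrs B v))) /= [X in _ + X]big1.
  rewrite addr0 (eq_bigr (fun=> s)).
    by rewrite sumr_const -mulr_natr natz.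
  by move=> w; move: (H w); rewrite !inE => /orP[/eqP->|/eqP->] //; rewrite eqxx.
by move=> w; rewrite inE negbK => /eqP.
Qed.

Lemma sink_source_signed B v : is_sink B v \/ is_source B v ->
  exists2 s : int, s \in [:: 1; -1] & forall w, hmx B v w \in [:: 0; s].
Proof.
have H (s : int) : (forall e, e \in edges B -> v \in e -> tau B (v, e) = s) ->
    forall w, hmx B v w \in [:: 0; s].
  move=> Hs w; case: (boolP ([set v; w] \in edges B)) => He.
    by rewrite /hmx Hs ?set21 // !inE eqxx orbT.
  by rewrite inE hmx_eq0 He.
by case=> /H; [exists 1|exists (-1)].
Qed.

Lemma large_degree_signed B v : #|V|%:Z - 2 <= `|netdeg B v| ->
  exists2 s : int, s \in [:: 1; -1] & forall w, hmx B v w \in [:: 0; s].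
Proof.
move=> Hd; have [h0 h3 _] := hmxP B.
pose s : int := if 0 <= netdeg B v then 1 else -1.
have s1 : s \in [:: 1; -1] by rewrite /s; case: ifP.
have Hsd : #|V|%:Z - 2 <= s * netdeg B v.
  suff -> : s * netdeg B v = `|netdeg B v| by [].
  by rewrite /s; case: ifP; lia.
exists s => // w; apply: contraT => Hw.
have wv : w != v by apply: contraNneq Hw => ->; rewrite h0 mem_head.
have hw : s * hmx B v w = -1.
  move: Hw (h3 v w) s1; rewrite !inE.
  by move=> nn /or3P[]/eqP E /orP[]/eqP F; move: nn; rewrite E F.
(* The term at [v] is 1, the wrong sign at [w] gives 2 and the other terms are nonnegative, so the
   sum is at least 3; by [Hsd] it is at most 2. *)
have : \sum_x (1 - s * hmx B v x) = #|V|%:Z - s * netdeg B v.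
  by rewrite sumrB -mulr_sumr -netdeg_hmx sumr_const -natz.
rewrite (bigD1 v) //= (bigD1 w) //= h0 hw mulr0.
have : 0 <= \sum_(x | (x != v) && (x != w)) (1 - s * hmx B v x).
  apply: sumr_ge0 => x _; move: (h3 v x) s1; rewrite !inE.
  by case/or3P=> /eqP-> /orP[]/eqP->.
move: (s * _) Hsd => t Hsd; set S : int := \sum_(x | _) _.
by move: S => S; move: (#|V|) Hsd => k; lia.
Qed.

Lemma abs_netdeg_signed B v (s : int) : s \in [:: 1; -1] ->
  (forall w, hmx B v w \in [:: 0; s]) -> `|netdeg B v| = #|nbrs B v|%:Z.
Proof. by rewrite !inE => s1 /netdeg_signed->; nia. Qed.

Lemma large_abs_netdeg B v : #|V|%:Z - 2 <= `|netdeg B v| ->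
  `|netdeg B v| = #|nbrs B v|%:Z.
Proof. by move=> /large_degree_signed[s s1 /(abs_netdeg_signed s1)]. Qed.

Lemma non_nbr_nearly_full B v w : large_degrees (netdeg B) ->
  w \in non_nbrs B v -> v \in nearly_full (netdeg B).
Proof.
move=> [Hd _] wN; rewrite inE; have /andP[lo _] := Hd v.
have pos : (0 < #|non_nbrs B v|)%N by apply/card_gt0P; exists w.
by have := large_abs_netdeg lo; have := card_nbrs B v; lia.
Qed.

Lemma non_nbrs_sym B v w : (w \in non_nbrs B v) = (v \in non_nbrs B w).
Proof. by have [_ _ hs] := hmxP B; rewrite !inE eq_sym hs. Qed.

(** The degree at [v] fixes the number of its non-neighbours, so [v] has some non-neighbour [w'] in
    [B']. All of [v], [w], [w'] are nearly full, and at most two nodes are, whence [w' = w]. *)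
Lemma large_degrees_non_nbrs B B' v w : large_degrees (netdeg B) ->
  netdeg B' = netdeg B -> w \in non_nbrs B v -> w \in non_nbrs B' v.
Proof.
move=> Hd E wN; have [HB H2] := Hd; have /andP[lo _] := HB v.
have [w' w'N] : exists w', w' \in non_nbrs B' v.
  apply/card_gt0P.
  have : (0 < #|non_nbrs B v|)%N by apply/card_gt0P; exists w.
  have := large_abs_netdeg lo; have := card_nbrs B v; have := card_nbrs B' v.
  by rewrite -E in lo *; have := large_abs_netdeg lo; lia.
have vS := non_nbr_nearly_full Hd wN.
have wS : w \in nearly_full (netdeg B).
  by apply: (@non_nbr_nearly_full _ _ v); rewrite // -non_nbrs_sym.
have w'S : w' \in nearly_full (netdeg B).
  rewrite -E; apply: (@non_nbr_nearly_full _ _ v); first by rewrite E.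
  by rewrite -non_nbrs_sym.
have [<-//|w'w] := eqVneq w' w.
have sub : v |: [set w; w'] \subset nearly_full (netdeg B).
  by apply/subsetP => x; rewrite in_setU1 in_set2 => /or3P[]/eqP->.
have := leq_trans (subset_leq_card sub) H2.
move: wN w'N; rewrite !inE => /andP[wv _] /andP[w'v _].
by rewrite cardsU1 !inE cards2 eq_sym (negPf wv) eq_sym (negPf w'v) eq_sym w'w.
Qed.

Lemma large_degrees_unique B B' : large_degrees (netdeg B) ->
  netdeg B' = netdeg B -> B' = B.
Proof.
move=> Hd E; have Hd' : large_degrees (netdeg B') by rewrite E.
apply: hmx_inj => v w; have [[h0 _ _] [h0' _ _]] := (hmxP B, hmxP B').
have [->|wv] := eqVneq w v; first by rewrite h0 h0'.
have NN : (hmx B' v w == 0) = (hmx B v w == 0).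
  apply/idP/idP => H.
    have := @large_degrees_non_nbrs B' B v w Hd' (esym E).
    by rewrite !inE wv H => /(_ isT).
  have := @large_degrees_non_nbrs B B' v w Hd E.
  by rewrite !inE wv H => /(_ isT).
have [s s1 Hs] := large_degree_signed (proj1 (andP (Hd.1 v))).
have [s' s1' Hs'] := large_degree_signed (proj1 (andP (Hd'.1 v))).
have := netdeg_signed Hs; have := netdeg_signed Hs'; rewrite E => -> Es.
move: NN (Hs w) (Hs' w); rewrite !inE.
have [->|nz] := eqVneq (hmx B v w) 0; first by move=> /eqP.
have [//|nz'] := eqVneq (hmx B' v w) 0; move=> _ /= /eqP-> /eqP->.
(* The neighbour [w] makes the common degree at [v] nonzero, so its sign forces [s = s']. *)
have : (0 < #|nbrs B v|)%N by apply/card_gt0P; exists w; rewrite inE.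
by move: s1 s1' Es; rewrite !inE; nia.
Qed.

(** At a sink or source the absolute net-degree counts the neighbours. Each non-neighbour of [v]
    gives a nonedge through [v], so there is at most one, and all nearly full nodes lie on the same
    nonedge, which has two nodes. *)
Lemma sink_source_large_degrees B :
  (forall v, is_sink B v \/ is_source B v) -> (#|nonedges B| <= 1)%N ->
  large_degrees (netdeg B).
Proof.
move=> Hs H1.
have dE v : `|netdeg B v| = #|nbrs B v|%:Z.
  by have [s s1 Hv] := sink_source_signed (Hs v); apply: abs_netdeg_signed Hv.
have NE v w : w \in non_nbrs B v -> [set v; w] \in nonedges B.
  by rewrite !inE hmx_eq0 cards2 eq_sym => /andP[-> ->].
have N1 v : (#|non_nbrs B v| <= 1)%N.
  apply/card_le1_eqP => w w' /NE Hw /NE Hw'; apply: (@set2_injr _ v).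
  by have /card_le1_eqP := H1; apply.
split=> [v|]; first by rewrite dE; have := card_nbrs B v; have := N1 v; lia.
have [->|[i iS]] := set_0Vmem (nearly_full (netdeg B)); first by rewrite cards0.
have Sin v : v \in nearly_full (netdeg B) ->
    exists2 e, e \in nonedges B & v \in e.
  rewrite inE dE => Hv; have : (0 < #|non_nbrs B v|)%N.
    by have := card_nbrs B v; lia.
  by case/card_gt0P => w /NE; exists [set v; w]; rewrite ?set21.
have [e eN _] := Sin i iS.
have e2 : #|e| = 2%N by move: eN; rewrite inE => /andP[/eqP].
rewrite -e2; apply/subset_leq_card/subsetP => v /Sin[f fN vf].
by have /card_le1_eqP/(_ e f eN fN) <- := H1.
Qed.

End Degree.

Theorem corollary4p8 (n : nat) (hn : (1 <= n)%N) :
  (forall B : bigraph 'I_n,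
     uniquely_realizable (netdeg B) <->
     (forall v : 'I_n, is_sink B v \/ is_source B v) /\
     (#|nonedges B| <= 1)%N)
  /\
  (forall d : {ffun 'I_n -> int},
     is_netdeg_seq d ->
     (uniquely_realizable d <->
      (forall i : 'I_n, n%:Z - 2 <= `|d i| <= n%:Z - 1) /\
      (#|[set i : 'I_n | (`|d i| == n%:Z - 2)%R]| <= 2)%N)).
Proof.
(* [U1], [sink_source_large_degrees] and [U2] close a cycle of implications among the three
   conditions, which yields both equivalences. *)
have U1 (B : bigraph 'I_n) : uniquely_realizable (netdeg B) ->
    (forall v, is_sink B v \/ is_source B v) /\ (#|nonedges B| <= 1)%N.
  move=> [B0 [_ uB0]].
  have uB B' : netdeg B' = netdeg B -> B' = B by move=> /uB0 <-; apply: uB0.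
  by split; [move=> v; apply: unique_sink_source|apply: unique_nonedges].
have U2 (B : bigraph 'I_n) : large_degrees (netdeg B) ->
    uniquely_realizable (netdeg B).
  by move=> Hd; exists B; split=> // B' /(large_degrees_unique Hd).
split=> [B|d [B <-]].
  by split=> [/U1//|[Hs H1]]; apply/U2/sink_source_large_degrees.
rewrite /large_degrees /nearly_full card_ord in U2.
split=> [/U1[Hs H1]|/U2//].
by have := sink_source_large_degrees Hs H1;
  rewrite /large_degrees /nearly_full card_ord.
Qed.
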